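(* Let $G$ be a finite group and let $\pi$ be a non-empty set of odd primes. Let $p$ be the smallest prime in $\pi$. Suppose that $d_\pi(G)>(p+1)/(2p)$. Then $G$ has a normal $\pi$-complement and an abelian Hall $\pi$-subgroup.
   Context: For a set of primes $\pi$, a $\pi$-element is an element whose order is divisible only by primes in $\pi$ (including the identity). $k_\pi(G)$ denotes the number of conjugacy classes of $G$ consisting of $\pi$-elements, $|G|_\pi$ is the $\pi$-part of $|G|$ (the largest divisor of $|G|$ all of whose prime factors lie in $\pi$), and $d_\pi(G)=k_\pi(G)/|G|_\pi$. A normal $\pi$-complement of $G$ is a normal subgroup $N$ such that no prime in $\pi$ divides $|N|$ and $|G:N|=|G|_\pi$. A Hall $\pi$-subgroup of $G$ is a subgroup of order $|G|_\pi$. *)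

(* Defs.v *)
From mathcomp Require Import all_boot all_order all_fingroup all_algebra all_solvable.

Set Implicit Arguments.
Unset Strict Implicit.
Unset Printing Implicit Defensive.

Definition k_pi (gT : finGroupType) (pi : nat_pred) (G : {group gT}) : nat :=
  #|[set C in classes G | [forall x in C, (pi.-elt x)%g]]|.

Definition d_pi (gT : finGroupType) (pi : nat_pred) (G : {group gT}) : rat :=
  ((k_pi pi G)%:R / (#|G|`_pi)%:R)%R.

Definition normal_pi_complement (gT : finGroupType) (pi : nat_pred)
    (G N : {group gT}) : Prop :=
  [/\ (N <| G)%g, (pi^'.-group N)%g & #|G : N|%g = #|G|`_pi].

(* Main.v *)
(** Splitting a pi-element into its tau- and tau'-parts and counting
    tau'-classes in the centraliser of the tau-part gives
    k_pi(G) <= k_tau(G) * |G|_(pi \ tau), whence d_pi(G) <= d_q(G) for each q in pi.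
    Let Q be a Sylow q-subgroup.  By Sylow's theorem k_q(G) is at most the number
    of orbits of 'N_G(Q) on Q; if 'N_G(Q) does not centralise Q, at most |Q| / q
    of these orbits are singletons, so d_q(G) <= (q + 1) / (2 q) <= (p + 1) / (2 p).
    Hence 'N_G(Q) centralises Q, and Burnside's transfer argument makes G' a
    q'-group.  This holds for every q in pi, so G' is a pi'-group, G / 'O_pi'(G)
    is an abelian pi-group, and Schur-Zassenhaus provides the Hall subgroup. *)
Require Import Defs.
From mathcomp Require Import all_boot all_order all_fingroup all_algebra all_solvable.
From mathcomp Require Import zify.

Section PiClasses.
Set Implicit Arguments.
Unset Strict Implicit.
Local Open Scope group_scope.

(** * Burnside fusion and transfer *)

Lemma Sylow_central_norm_fusion (gT : finGroupType) (p : nat) (G Q : {group gT}) x g :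
    p.-Sylow(G) Q -> 'N_G(Q) \subset 'C(Q) ->
    x \in Q -> g \in G -> x ^ g \in Q -> x ^ g = x.
Proof.
move=> sylQ cNQ Qx Gg Qxg; have sQG := pHall_sub sylQ.
have cQQ: abelian Q by rewrite /abelian (subset_trans _ cNQ) // subsetI sQG normG.
(* Q and its conjugate by g are both Sylow in the centraliser of x ^ g. *)
have sylC (P : {group gT}): p.-Sylow(G) P -> P \subset 'C[x ^ g] ->
    p.-Sylow('C_G[x ^ g]) P.
  move=> sylP cPxg; apply: pHall_subl (sylP); last exact: subsetIl.
  by rewrite subsetI (pHall_sub sylP).
have sylQg: p.-Sylow('C_G[x ^ g]) (Q :^ g).
  apply: sylC; first by rewrite pHallJ.
  by rewrite cent1J conjSg sub_cent1 (subsetP cQQ).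
have{sylC} sylQ': p.-Sylow('C_G[x ^ g]) Q.
  by apply: sylC => //; rewrite sub_cent1 (subsetP cQQ).
have [c /setIP[Gc /cent1P cxg] defQ] := Sylow_trans sylQg sylQ'.
(* Since [c] carries [Q :^ g] back to [Q], the product [g * c] normalises [Q] and so fixes [x];
   moreover [c] fixes [x ^ g]. *)
have /(subsetP cNQ)/centP/(_ x Qx) cx: g * c \in 'N_G(Q).
  by rewrite inE groupM //; apply/normP; rewrite conjsgM -defQ.
have: x ^ (g * c) = x by apply/conjg_fixP/commgP.
by rewrite conjgM (conjgE _ c) -cxg mulKg.
Qed.

(** On [Q] the transfer is the power map with exponent [#|G : Q|], injective by coprimality. Its
    kernel contains G', so [Q] meets G' trivially, and a Sylow subgroup of G', being conjugate into
    [Q], is trivial. *)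
Lemma Sylow_central_norm_der1 (gT : finGroupType) (p : nat) (G Q : {group gT}) :
    p.-Sylow(G) Q -> 'N_G(Q) \subset 'C(Q) -> p^'.-group G^`(1).
Proof.
move=> sylQ cNQ; have sQG := pHall_sub sylQ.
have cQQ: abelian Q by rewrite /abelian (subset_trans _ cNQ) // subsetI sQG normG.
have abQ: abelian (idm Q @* Q) by rewrite morphim_idm.
pose T := transfer_morphism G abQ.
(* Burnside fusion turns every factor of the cycle expansion into a power of x. *)
have TQ x : x \in Q -> FiniteModule.fmval (T x) = x ^+ #|G : Q|.
  move=> Qx; have Gx := subsetP sQG x Qx.
  have trX := transversalP (rcosets_cycle_partition sQG Gx).
  rewrite /T /= (transfer_cycle_expansion sQG abQ Gx trX).
  rewrite -(sum_index_rcosets_cycle sQG Gx trX).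
  rewrite FiniteModule.fmval_sum (big_morph _ (expgD x) (expg0 x)) /=.
  apply: eq_bigr => y Xy.
  have Gy := subsetP (transversal_sub trX) y Xy.
  have := mulg_exp_card_rcosets Q x y; set n := #|_ : _|.
  rewrite mem_rcoset => Qxn.
  have E: (x ^+ n) ^ y^-1 = x ^+ n.
    apply: (Sylow_central_norm_fusion sylQ cNQ); rewrite ?groupX ?groupV //.
    by rewrite conjgE invgK mulgA.
  by rewrite E FiniteModule.fmodK //= morphim_idm ?groupX.
have sG'K: G^`(1) \subset 'ker T.
  rewrite der1_min ?ker_norm //.
  rewrite (isog_abelian (first_isog T)).
  by apply/centsP => u _ v _; apply: GRing.addrC.
have tiG'Q: Q :&: G^`(1) = 1.
  apply/trivgP/subsetP=> x /setIP[Qx /(subsetP sG'K) Kx].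
  have:= TQ x Qx; rewrite (mker Kx) => /esym xn1.
  have co: coprime #|Q| #|G : Q|.
    by case/and3P: sylQ => _ pQ; apply: pnat_coprime.
  by rewrite inE -(expgK co Qx) xn1 expg1n.
have [R sylR] := Sylow_exists p G^`(1).
have [sRG' pR _] := and3P sylR.
have [y Gy sRyQ] := Sylow_Jsub sylQ (subset_trans sRG' (der_sub 1 G)) pR.
rewrite /pgroup -partn_eq1 // -(card_Hall sylR) -(cardJg R y) -trivg_card1.
rewrite -subG1 -tiG'Q subsetI sRyQ -(normsP (der_norm 1 G) y Gy).
by rewrite conjSg.
Qed.

(** * Counting classes of pi-elements *)

Lemma k_piE (gT : finGroupType) (pi : nat_pred) (G : {group gT}) :
  k_pi pi G = #|[set x ^: G | x in G & pi.-elt x]|.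
Proof.
apply: eq_card => C; rewrite !inE; apply/andP/imsetP=> [[] | [x]].
  case/imsetP=> x Gx -> /forall_inP pix; exists x => //.
  by rewrite inE Gx pix ?class_refl.
rewrite inE => /andP[Gx pix] ->; split; first exact: mem_classes.
by apply/forall_inP=> _ /imsetP[y Gy ->]; rewrite p_eltJ.
Qed.

Lemma leq_k_pi_Sylow_classes (gT : finGroupType) (p : nat) (G Q N : {group gT}) :
  p.-Sylow(G) Q -> N \subset G -> k_pi p G <= #|[set x ^: N | x in Q]|.
Proof.
move=> sylQ sNG; have sQG := pHall_sub sylQ; rewrite k_piE.
(* Sending an [N]-class in [Q] to the [G]-class containing it reaches every class of p-elements, by
   Sylow. *)
apply: leq_trans (leq_imset_card (fun C => repr C ^: G) _).
apply/subset_leq_card/subsetP=> _ /imsetP[x /[!inE] /andP[Gx px] ->].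
have [|y Gy sxyQ] := Sylow_Jsub sylQ _ px; first by rewrite cycle_subG.
have Qxy: x ^ y \in Q by rewrite (subsetP sxyQ) // memJ_conjg cycle_id.
apply/imsetP; exists ((x ^ y) ^: N); first exact: imset_f.
have [z Nz ->] := repr_class N (x ^ y).
by rewrite !classGidl // (subsetP sNG).
Qed.

(** The class of [x] is mapped to the class of its [tau]-part [y]; the assumed bound, applied to
    ['C_G[y]], controls each fibre. *)
Lemma k_pi_prod (gT : finGroupType) (pi tau : nat_pred) (G : {group gT}) :
    (forall H : {group gT}, k_pi [predI pi & tau^'] H <= #|H|`_[predI pi & tau^']) ->
  k_pi pi G <= k_pi tau G * #|G|`_[predI pi & tau^'].
Proof.
set rho := [predI pi & tau^'] => le_rho.
set A := [set x in G | pi.-elt x].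
pose f (C : {set gT}) := (repr C).`_tau ^: G.
rewrite k_piE -sum1_card (partition_big_imset f) /= -/A.
set B := f @: _.
have sBk: B \subset [set x ^: G | x in G & tau.-elt x].
  apply/subsetP=> _ /imsetP[_ /imsetP[x /[!inE]/andP[Gx _] ->] ->].
  rewrite /f; have [y Gy ->] := repr_class G x.
  rewrite consttJ classGidl //; apply/imsetP; exists x.`_tau => //.
  by rewrite inE p_elt_constt groupX.
apply: leq_trans (_ : #|B| * #|G|`_rho <= _); last first.
  by rewrite leq_mul2r orbC k_piE subset_leq_card.
rewrite -sum_nat_const; apply: leq_sum => D BD.
have [y /[!inE] /andP[Gy tauy] defD] := imsetP (subsetP sBk D BD).
rewrite sum1dep_card.
have le_C: k_pi rho 'C_G[y] <= #|G|`_rho.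
  by rewrite (leq_trans (le_rho _)) // dvdn_leq ?partn_dvd ?cardSg ?subsetIl.
apply: leq_trans le_C; rewrite k_piE.
apply: leq_trans (leq_imset_card (fun C => (y * repr C) ^: G) _).
apply/subset_leq_card/subsetP=> _ /[!inE] /andP[/imsetP[x /[!inE] /andP[Gx pix] ->]].
rewrite /f; have [z Gz ->] := repr_class G x; rewrite consttJ classGidl // defD.
move=> /eqP/class_eqP/imsetP[u Gu def_y].
(* This conjugate of [x] has [tau]-part exactly [y], so its other part lies in ['C_G[y]]. *)
pose x1 := x ^ u^-1.
have Gx1: x1 \in G by rewrite groupJ ?groupV.
have x1tau: x1.`_tau = y by rewrite consttJ def_y conjgK.
have pix1: pi.-elt x1 by rewrite p_eltJ.
have cyx: commute y x1.`_tau^' by rewrite -x1tau; apply/commuteX2.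
have Cx1: x1.`_tau^' \in 'C_G[y] by rewrite inE groupX //; apply/cent1P/esym.
have [w /setIP[Gw /cent1P cyw] rep_w] := repr_class 'C_G[y] x1.`_tau^'.
apply/imsetP; exists (x1.`_tau^' ^: 'C_G[y]).
  apply: imset_f; rewrite inE Cx1 /= /rho /p_elt pnatI.
  apply/andP; split; last exact: p_elt_constt.
  by apply: (mem_p_elt pix1); apply: mem_cycle.
have ycw: y ^ w = y by apply/conjg_fixP/commgP/esym.
by rewrite rep_w -[y in y * _]ycw -conjMg -{1}x1tau consttC !classGidl ?groupV.
Qed.

Lemma eq_in_k_pi (gT : finGroupType) (pi rho : nat_pred) (G : {group gT}) :
  {in \pi(G), pi =i rho} -> k_pi pi G = k_pi rho G.
Proof.
move=> eq_pi; rewrite !k_piE.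
suff ->: [set x in G | pi.-elt x] = [set x in G | rho.-elt x] by [].
apply/setP=> x; rewrite !inE; apply: andb_id2l => Gx.
apply: eq_in_pnat => q; rewrite mem_primes.
case/and3P=> q_pr _ q_x; apply: eq_pi.
by rewrite mem_primes q_pr cardG_gt0 (dvdn_trans q_x) ?order_dvdG.
Qed.

Lemma k_p_leq_part (gT : finGroupType) (p : nat) (G : {group gT}) :
  k_pi p G <= #|G|`_p.
Proof.
have [Q sylQ] := Sylow_exists p G; rewrite -(card_Hall sylQ).
exact: leq_trans (leq_k_pi_Sylow_classes sylQ (subxx G)) (leq_imset_card _ _).
Qed.

Lemma k_pi_leq_part (gT : finGroupType) (pi : nat_pred) (G : {group gT}) :
  k_pi pi G <= #|G|`_pi.
Proof.
(* Induction on a strict bound [m] for [rho], splitting off [m] itself; [H] varies because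
   [k_pi_prod] needs the bound for all groups. *)
have bounded m (rho : nat_pred) (H : {group gT}) :
    {in rho, forall q, q < m} -> k_pi rho H <= #|H|`_rho.
  elim: m => [|m IHm] in rho H * => ltm.
    (* Here [rho] is empty; as 0 is not prime, [rho] agrees on primes with the singleton predicate
       of 0, so the one-prime bound applies. *)
    have eq_rho: {in \pi(H), rho =i (0 : nat_pred)}.
      move=> q /[!mem_primes] /and3P[q_pr _ _]; rewrite [RHS]inE eqn0Ngt prime_gt0 //.
      by apply/negP=> /ltm.
    by rewrite (eq_in_k_pi eq_rho) (eq_in_partn eq_rho) k_p_leq_part.
  have [rho_m|rho'm] := boolP (m \in rho); last first.
    apply: IHm => q rho_q; rewrite ltn_neqAle -ltnS ltm // andbT.
    by apply: contraNneq rho'm => <-.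
  apply: leq_trans (@k_pi_prod gT rho m H _) _ => [K|].
    by apply: IHm => q /[!inE] /andP[/ltm]; rewrite ltnS ltn_neqAle => -> ->.
  rewrite -(partnC m (part_gt0 rho #|H|)) partnI leq_mul2r.
  by rewrite (@partn_part m) => [|q /eqnP-> //]; rewrite k_p_leq_part orbT.
(* Primes above the order of [G] are irrelevant, so [pi] may be truncated. *)
pose rho : nat_pred := [predI pi & gtn #|G|.+1].
have eq_rho: {in \pi(G), pi =i rho}.
  move=> q; rewrite mem_primes inE /= => /and3P[_ _ /dvdn_leq q_G].
  by rewrite /in_mem /= ltnS q_G ?andbT.
rewrite (eq_in_k_pi eq_rho) (eq_in_partn eq_rho).
by apply: (bounded #|G|.+1) => q /andP[].
Qed.

(** An orbit has at least two points, or is a single fixed point, which is then counted twice on the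
    right. *)
Lemma leq_double_classes (gT : finGroupType) (N Q : {group gT}) :
  N \subset 'N(Q) -> 2 * #|[set x ^: N | x in Q]| <= #|Q| + #|'C_Q(N)|.
Proof.
move=> nQN; have actQ: [acts N, on Q | 'J] by rewrite astabsJ.
have := orbit_partition actQ; rewrite (eq_imset _ (orbitJ N)).
set O := imset _ _ => partO.
have cardC: #|'C_Q(N)| = \sum_(C in O) #|C :&: 'C(N)|.
  transitivity (\sum_(x in Q | x \in 'C(N)) 1)%N.
    by rewrite -sum1_card; apply: eq_bigl => x; rewrite inE.
  rewrite (set_partition_big_cond _ partO) /=; apply: eq_bigr => C _.
  by rewrite -sum1_card; apply: eq_bigl => x; rewrite inE.
rewrite (card_partition partO) cardC -big_split /= mulnC -sum_nat_const.
apply: leq_sum => _ /imsetP[x Qx ->].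
have [le1|lt1] := leqP #|x ^: N| 1; last by rewrite (leq_trans lt1) ?leq_addr.
have def_xN: [set x] = x ^: N.
  by apply/eqP; rewrite eqEcard sub1set class_refl cards1.
suff cNx: x \in 'C(N) by rewrite -def_xN (setIidPl _) ?sub1set // cards1.
apply/centP=> y Ny; apply/commgP/conjg_fixP/set1P.
by rewrite def_xN memJ_class.
Qed.

Lemma k_p_Sylow_norm_central (gT : finGroupType) (p : nat) (G Q : {group gT}) :
    prime p -> p.-Sylow(G) Q -> p.+1 * #|G|`_p < 2 * p * k_pi p G ->
  'N_G(Q) \subset 'C(Q).
Proof.
move=> p_pr sylQ; apply: contraLR => not_cQN; rewrite -leqNgt.
have pQ := pHall_pgroup sylQ.
have nQN: 'N_G(Q) \subset 'N(Q) by apply: subsetIr.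
have := leq_k_pi_Sylow_classes sylQ (subsetIl G 'N(Q)).
have := leq_double_classes nQN; rewrite -(card_Hall sylQ).
(* The fixed points form a proper subgroup of the p-group [Q], hence of index at least [p]. *)
suff: p * #|'C_Q('N_G(Q))| <= #|Q|.
  move: #|_| #|_| #|_| (k_pi _ _) => c q o k; nia.
rewrite -(Lagrange (subsetIl Q 'C('N_G(Q)))) mulnC leq_mul2l; apply/orP; right.
have [n def_i] := p_natP (pnat_dvd (dvdn_indexg Q 'C_Q('N_G(Q))) pQ).
case: n def_i => [/eqP|n ->]; last by rewrite expnS leq_pmulr ?expn_gt0 ?prime_gt0.
by rewrite indexg_eq1 subsetI subxx /= centsC (negPf not_cQN).
Qed.

(** This is d_pi(G) <= d_p(G) with denominators cleared. *)
Lemma k_pi_leq_k_p (gT : finGroupType) (pi : nat_pred) (p : nat) (G : {group gT}) :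
  p \in pi -> k_pi pi G * #|G|`_p <= k_pi p G * #|G|`_pi.
Proof.
move=> pi_p; rewrite -(partnC p (part_gt0 pi #|G|)).
rewrite (@partn_part p) => [|q /eqnP-> //].
rewrite -partnI mulnCA [leqLHS]mulnC leq_mul2l; apply/orP; right.
by apply: k_pi_prod => H; apply: k_pi_leq_part.
Qed.

(** The quotient by ['O_pi(G)] is abelian with trivial [pi]-core, hence equals its [pi^']-core. *)
Lemma Hall_pcore_of_der1 (gT : finGroupType) (pi : nat_pred) (G : {group gT}) :
  pi.-group G^`(1) -> pi.-Hall(G) 'O_pi(G).
Proof.
move=> piG'; rewrite /pHall pcore_sub pcore_pgroup /=.
rewrite -card_quotient ?gFnorm //.
have abGN: abelian (G / 'O_pi(G)).
  by rewrite sub_der1_abelian // pcore_max ?der_normal.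
rewrite -(dprodW (nilpotent_pcoreC pi (abelian_nil abGN))).
by rewrite trivg_pcore_quotient mul1g; apply: pcore_pgroup.
Qed.

Lemma d_pi_gtE (gT : finGroupType) (pi : nat_pred) (p : nat) (G : {group gT}) :
    0 < p ->
  ((p%:R + 1) / (2 * p%:R) < d_pi pi G)%R = (p.+1 * #|G|`_pi < 2 * p * k_pi pi G).
Proof.
move=> p_gt0; rewrite /d_pi Num.Theory.ltr_pdivlMr ?Num.Theory.ltr0n ?part_gt0 //.
rewrite GRing.mulrAC Num.Theory.ltr_pdivrMr; last first.
  by rewrite Num.Theory.mulr_gt0 ?Num.Theory.ltr0n.
by rewrite GRing.natr1 -!GRing.natrM Num.Theory.ltr_nat [X in _ < X]mulnC.
Qed.

End PiClasses.

Theorem theoremE (gT : finGroupType) (G : {group gT}) (pi : nat_pred) (p : nat)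
    (pi_odd_primes : forall q : nat, q \in pi -> prime q /\ odd q)
    (p_in_pi : p \in pi)
    (p_min : forall q : nat, q \in pi -> p <= q)
    (d_pi_gt : ((p%:R + 1) / (2 * p%:R) < d_pi pi G)%R) :
  (exists N : {group gT}, normal_pi_complement pi G N) /\
  (exists H : {group gT}, (pi.-Hall(G) H)%g /\ abelian H).
Proof.
have prime_pi q: q \in pi -> prime q by case/pi_odd_primes.
have p_gt0: (0 < p)%N by rewrite prime_gt0 ?prime_pi.
rewrite d_pi_gtE // in d_pi_gt.
have piG': (pi^'.-group G^`(1))%g.
  apply/pgroupP => q q_pr q_dv; apply/negP => pi_q.
  have [Q sylQ] := Sylow_exists q G.
  have cNQ: ('N_G(Q) \subset 'C(Q))%g.
    apply: (k_p_Sylow_norm_central q_pr sylQ).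
    have := k_pi_leq_k_p G pi_q; have := p_min q pi_q.
    have := part_gt0 pi #|G|; have := part_gt0 q #|G|.
    move: (k_pi pi G) (k_pi q G) (_`_pi)%N (_`_q)%N d_pi_gt => k kq n nq lt_k.
    move=> nq_gt0 n_gt0 le_pq le_k.
    (* The bound passes from [pi] to [q] after cancelling [n]; it then passes from [p] to [q]
       because (t + 1) / (2 t) decreases in t. *)
    have lt1: (p.+1 * nq < 2 * p * kq)%N.
      rewrite -(ltn_pmul2l n_gt0); move: lt_k le_k nq_gt0; nia.
    nia.
  have /pgroupP/(_ q q_pr q_dv) := Sylow_central_norm_der1 sylQ cNQ.
  by rewrite !inE eqxx.
have hallN := Hall_pcore_of_der1 piG'.
set N := 'O_pi^'(G)%G in hallN.
have nsNG: (N <| G)%g by apply: pcore_normal.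
split.
  exists N; split=> //; first exact: pcore_pgroup.
  rewrite -divgS ?normal_sub // (card_Hall hallN).
  by rewrite -{1}(partnC pi (cardG_gt0 G)) mulnK ?part_gt0.
have /splitsP[H] := SchurZassenhaus_split (pHall_Hall hallN) nsNG.
rewrite (compl_p'Hall H hallN) => hallH; exists H; split=> //.
(* H' lies in both [H] and [N], whose orders are coprime. *)
apply/derG1P/eqP; rewrite -subG1.
rewrite -(coprime_TIg (pnat_coprime (pHall_pgroup hallH) (pHall_pgroup hallN))).
rewrite subsetI der_sub (subset_trans (dergS 1 (pHall_sub hallH))) //.
by rewrite pcore_max ?der_normal.
Qed.
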